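(* There exist absolute constants $c_0,c_1,c_2,C>0$ such that the following holds for all integers $n,p\ge 2$, all $q\in(0,1/2]$ and all $x^*\in\mathbb{R}_+^p$ with support $S^*=\{k:x^*_k\ne0\}$ of size $s=|S^*|$. If $$s\le c_0\,\frac{nq^2}{\log p},$$ then, with probability exceeding $1-C/p$, the oracle least squares estimate $\hat x^{\rm OLS}$ of $x^*$ on $S^*$ satisfies $$c_1\sum_{k\in S^*}\big(\tilde A^\top(\tilde Y-\tilde Ax^* )\big)_k^2\ \le\ \|\hat x^{\rm OLS}-x^*\|_2^2\ \le\ c_2\sum_{k\in S^*}\big(\tilde A^\top(\tilde Y-\tilde Ax^* )\big)_k^2 .$$
   Context: Model: $A=(a_{\ell,k})\in\{0,1\}^{n\times p}$ has i.i.d. Bernoulli($q$) entries, and conditionally on $A$ the entries $Y_1,\dots,Y_n$ of $Y$ are independent with $Y_\ell\sim\mathrm{Poisson}((Ax^* )_\ell)$. Let $\mathbf 1_n\in\mathbb{R}^n$, $\mathbf 1_p\in\mathbb{R}^p$ be the all-ones vectors and $$\tilde A=\frac{A-q\,\mathbf 1_n\mathbf 1_p^\top}{\sqrt{nq(1-q)}},\qquad \tilde Y=\frac{1}{(n-1)\sqrt{nq(1-q)}}\Big(nY-\Big(\sum_{\ell=1}^nY_\ell\Big)\mathbf 1_n\Big).$$ The oracle least squares estimate is $\hat x^{\rm OLS}=I_{S^*}(\tilde A_{S^*})^{\#}\tilde Y$, where $\tilde A_{S^*}\in\mathbb{R}^{n\times s}$ (resp. $I_{S^*}\in\mathbb{R}^{p\times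 s}$) is the submatrix of $\tilde A$ (resp. of the identity $I_p$) formed by the columns indexed by $S^*$, and $(\cdot)^{\#}$ is the (Moore–Penrose) pseudo-inverse; in particular $\hat x^{\rm OLS}$ vanishes outside $S^*$. *)

(* Defs.v *)
From HB Require Import structures.
From mathcomp Require Import all_boot all_order all_algebra.
From mathcomp Require Import all_classical all_reals all_analysis.

Set Implicit Arguments.
Unset Strict Implicit.
Unset Printing Implicit Defensive.

Import Order.TTheory GRing.Theory Num.Theory.
Import numFieldNormedType.Exports.

Local Open Scope classical_set_scope.
Local Open Scope ring_scope.

Section pseudo_inverse.
Context {R : realFieldType}.

(* The four Penrose equations; [pinvmx] of mxalgebra is only a partial inverse
   and does not satisfy the two symmetry conditions in general. *)
Definition is_moore_penrose (m n : nat) (M : 'M[R]_(m, n)) (X : 'M[R]_(n, m)) :=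
  [/\ M *m X *m M = M, X *m M *m X = X,
      (M *m X)^T = M *m X & (X *m M)^T = X *m M].

Definition moore_penrose (m n : nat) (M : 'M[R]_(m, n)) : 'M[R]_(n, m) :=
  xget 0 [set X | is_moore_penrose M X].

Lemma is_moore_penrose_uniq m n (M : 'M[R]_(m, n)) X1 X2 :
  is_moore_penrose M X1 -> is_moore_penrose M X2 -> X1 = X2.
Proof.
move=> [a1 b1 c1 d1] [a2 b2 c2 d2].
have eL : M *m X1 = M *m X2.
  rewrite -[LHS]c1 -[in LHS]a2 -(mulmxA (M *m X2)) trmx_mul c1 c2.
  by rewrite mulmxA a1.
have eR : X1 *m M = X2 *m M.
  rewrite -[LHS]d1 -[in LHS]a2 -(mulmxA M X2) mulmxA trmx_mul d1 d2.
  by rewrite -mulmxA (mulmxA M) a1.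
by rewrite -b1 eR -mulmxA eL mulmxA b2.
Qed.

Lemma row_free_gram_unit m n (M : 'M[R]_(m, n)) :
  row_free M -> M *m M^T \in unitmx.
Proof.
move=> fM; rewrite -row_free_unit -kermx_eq0; apply/rowV0P => u /sub_kermxP uM.
have : (u *m M) *m (u *m M)^T = 0 by rewrite trmx_mul mulmxA -(mulmxA u) uM mul0mx.
set v := u *m M => /matrixP/(_ 0 0); rewrite !mxE => v0.
have {}v0 : v = 0.
  apply/rowP => j; rewrite [RHS]mxE; apply/eqP; rewrite -sqrf_eq0; apply/eqP.
  have s0 : \sum_k v 0 k ^+ 2 = 0.
    by rewrite -[RHS]v0; apply: eq_bigr => k _; rewrite [_^T _ _]mxE -expr2.
  by apply: (psumr_eq0P _ s0) => // k _; exact: sqr_ge0.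
by apply: (row_free_inj fM); rewrite mul0mx.
Qed.

Lemma is_moore_penrose_ex m n (M : 'M[R]_(m, n)) :
  exists X, is_moore_penrose M X.
Proof.
have [r [C [F [fC fF MCF]]]] : exists r (C : 'M[R]_(m, r)) (F : 'M[R]_(r, n)),
    [/\ row_full C, row_free F & M = C *m F].
  exists (\rank M), (col_base M), (row_base M).
  by rewrite col_base_full row_base_free mulmx_base.
have uF : F *m F^T \in unitmx by exact: row_free_gram_unit.
have uC : C^T *m C \in unitmx.
  rewrite -{2}(trmxK C); apply: row_free_gram_unit.
  by rewrite /row_free mxrank_tr.
set G := invmx (F *m F^T); set K := invmx (C^T *m C).
have GT : G^T = G by rewrite /G trmx_inv trmx_mul trmxK.
have KT : K^T = K by rewrite /K trmx_inv trmx_mul trmxK.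
set X := F^T *m G *m K *m C^T.
have MX : M *m X = C *m K *m C^T.
  rewrite MCF /X !mulmxA -(mulmxA C F) -(mulmxA C (F *m F^T)) mulmxV//.
  by rewrite mulmx1.
have XM : X *m M = F^T *m G *m F.
  rewrite MCF /X !mulmxA -(mulmxA _ C^T C) -(mulmxA _ K) mulVmx//.
  by rewrite mulmx1.
exists X; split.
- rewrite MX MCF !mulmxA -(mulmxA _ C^T C) -(mulmxA _ K) mulVmx//.
  by rewrite mulmx1.
- rewrite XM /X !mulmxA -(mulmxA _ F F^T) -(mulmxA _ (F *m F^T)) mulmxV//.
  by rewrite mulmx1.
- by rewrite MX !trmx_mul trmxK KT mulmxA.
- by rewrite XM !trmx_mul trmxK GT mulmxA.
Qed.

Lemma moore_penroseP m n (M : 'M[R]_(m, n)) :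
  is_moore_penrose M (moore_penrose M).
Proof.
by have [X hX] := is_moore_penrose_ex M; exact: (@xgetPex _ _ [set _ | _] (ex_intro _ X hX)).
Qed.

End pseudo_inverse.

Section probability_notions.
Context {R : realType} {d : measure_display} {T : measurableType d}.

(* [mu] is either a probability or a conditional probability, whence a plain
   set function. *)
Definition mutually_independent (d' : measure_display) (T' : measurableType d')
    (I : finType) (mu : set T -> \bar R) (X : I -> T -> T') : Prop :=
  forall (J : {set I}) (B : I -> set T'), (forall i, measurable (B i)) ->
    mu (\bigcap_(i in [set` J]) (X i @^-1` B i)) =
    (\prod_(i in J) mu (X i @^-1` B i))%E.

(* Elementary conditional probability, meaningful when [0 < P F]. *)
Definition cond_prob (P : probability T R) (F : set T) : set T -> \bar R :=
  fun E => (P (E `&` F) * ((fine (P F))^-1)%:E)%E.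

End probability_notions.

Section model.
Context {R : realType} {n p : nat}.

Definition real_mx (a : 'M[bool]_(n, p)) : 'M[R]_(n, p) :=
  map_mx (fun b : bool => b%:R) a.

Definition real_cv (y : 'cV[nat]_n) : 'cV[R]_n :=
  map_mx (fun k : nat => k%:R) y.

Context {d : measure_display} {T : measurableType d}.

Definition random_mx (P : probability T R)
    (A : 'I_n -> 'I_p -> {RV P >-> bool}) (w : T) : 'M[bool]_(n, p) :=
  \matrix_(l, k) A l k w.

Definition random_cv (P : probability T R)
    (Y : 'I_n -> {RV P >-> nat}) (w : T) : 'cV[nat]_n :=
  \col_l Y l w.

(* The second argument of [poisson_prob] is a dummy, and [poisson_prob 0 _] is
   the Dirac mass at 0.  All subsets of [bool] and [nat] are measurable. *)
Definition bernoulli_poisson_model (P : probability T R) (q : R) (x : 'cV[R]_p)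
    (A : 'I_n -> 'I_p -> {RV P >-> bool}) (Y : 'I_n -> {RV P >-> nat}) : Prop :=
  [/\ mutually_independent P
        (fun lk : 'I_n * 'I_p => A lk.1 lk.2 : T -> bool),
      forall l k (B : set bool), distribution P (A l k) B = bernoulli_prob q B
    & forall a : 'M[bool]_(n, p),
        let F := [set w | random_mx A w = a] in
        (0 < P F)%E ->
        mutually_independent (cond_prob P F) (fun l => Y l : T -> nat) /\
        forall l (B : set nat),
          cond_prob P F (Y l @^-1` B) =
          poisson_prob ((real_mx a *m x) l 0) 0 B].

End model.

Section estimator.
Context {R : realType} {n p : nat}.

Definition l2norm (m : nat) (v : 'cV[R]_m) : R :=
  Num.sqrt (\sum_(k < m) v k 0 ^+ 2).

Definition mx_tilde (q : R) (A : 'M[R]_(n, p)) : 'M[R]_(n, p) :=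
  (Num.sqrt (n%:R * q * (1 - q)))^-1 *:
    (A - q *: ((const_mx 1 : 'cV[R]_n) *m (const_mx 1 : 'cV[R]_p)^T)).

Definition cv_tilde (q : R) (Y : 'cV[R]_n) : 'cV[R]_n :=
  ((n%:R - 1) * Num.sqrt (n%:R * q * (1 - q)))^-1 *:
    (n%:R *: Y - (\sum_l Y l 0) *: const_mx 1).

Definition supp (x : 'cV[R]_p) : {set 'I_p} := [set k | x k 0 != 0]%SET.

Definition cols (m : nat) (S : {set 'I_p}) (M : 'M[R]_(m, p)) : 'M[R]_(m, #|S|) :=
  colsub (fun i : 'I_#|S| => enum_val i) M.

Definition ols (S : {set 'I_p}) (At : 'M[R]_(n, p)) (Yt : 'cV[R]_n) : 'cV[R]_p :=
  cols S 1%:M *m moore_penrose (cols S At) *m Yt.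

End estimator.

(* Main.v *)
Require Import Defs.
From HB Require Import structures.
From mathcomp Require Import all_boot all_order all_algebra.
From mathcomp Require Import all_classical all_reals all_analysis.
From mathcomp Require Import ring lra.

Set Implicit Arguments.
Unset Strict Implicit.
Unset Printing Implicit Defensive.

Import Order.TTheory GRing.Theory Num.Theory.
Import numFieldNormedType.Exports.

Local Open Scope classical_set_scope.
Local Open Scope ring_scope.

(** Write [M] for the rescaled design matrix, [S] for the support of [x],
    [s] for its cardinality and [|v|^2] for the squared Euclidean norm.  The
    statement splits into a deterministic half and a probabilistic one.

    Deterministic half.  The residual of the least squares fit is orthogonal
    to the columns of [M] in [S]; this follows from the Penrose equations
    alone, whatever the rank of these columns ([ols_normal_equation]).  Hence
    the error [z] of the oracle estimate satisfies
    [M_S^T M z = M_S^T (y - M x)], and as soon as [M] distorts the squared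
    norm of vectors supported in [S] by at most constant factors, [|z|^2] and
    [|M_S^T (y - M x)|^2] are comparable, for every [y]
    ([ols_error_bounds]).

    Probabilistic half.  It remains to show that, except with probability
    [2 / p], [|M v|^2] is between [|v|^2 / 16] and [7 |v|^2] for all [v]
    supported in [S].  For one unit vector [v], [|M v|^2] is the average over
    the [n] independent rows of [W^2 / (q (1 - q))], where [W] is a sum of
    independent centred variables and hence subgaussian with an absolute
    constant.  So [E exp(W^2 / 24)] is bounded, and a second order expansion
    of the exponential gives
    [E exp(lam W^2) <= exp(lam q (1 - q) + D lam^2)] for small [lam] of
    either sign ([rowform_sqr_mgf_le]).  Chernoff's bound with [lam] of order
    [q (1 - q)] shows that [|M v|^2] deviates from [|v|^2] by more than
    [|v|^2 / 2] with probability at most [2 exp(- n q^2 / (64 D))]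
    ([energy_deviation]).

    A union bound extends this to all vectors of a cubic grid with mesh of
    order [1 / s], which has at most [(16 s + 1)^s <= p^(6 s)] points: this is
    affordable exactly because [s ln p] is small compared with [n q^2].  Such
    a fine grid makes the rounding step trivial: the rounding error is so
    small that the Frobenius norm of [M_S], itself controlled on the grid
    since the grid contains the canonical basis, absorbs it
    ([riesz_of_grid]).

    The design matrix takes finitely many values, so all these expectations
    are finite sums weighted by products of Bernoulli weights, and those
    products are its law ([random_mx_prob]). *)

(** * Squared norms and inner products *)

Section squared_norm.
Context {R : realType}.
Implicit Types (m p : nat).

(** Lagrange's identity: the difference of the two sides is half the double
    sum of the squares of [a i * b j - a j * b i]. *)
Lemma cauchy_schwarz_sum (I : Type) (r : seq I) (D : pred I) (a b : I -> R) :
  (\sum_(i <- r | D i) a i * b i) ^+ 2 <=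
  (\sum_(i <- r | D i) a i ^+ 2) * (\sum_(i <- r | D i) b i ^+ 2).
Proof.
have : 0 <= \sum_(i <- r | D i) \sum_(j <- r | D j)
    (a i * b j - a j * b i) ^+ 2.
  by apply: sumr_ge0 => i _; apply: sumr_ge0 => j _; exact: sqr_ge0.
have -> : \sum_(i <- r | D i) \sum_(j <- r | D j) (a i * b j - a j * b i) ^+ 2 =
    \sum_(i <- r | D i) \sum_(j <- r | D j) a i ^+ 2 * b j ^+ 2
    - (\sum_(i <- r | D i) \sum_(j <- r | D j) (a i * b i) * (a j * b j)) *+ 2
    + \sum_(i <- r | D i) \sum_(j <- r | D j) b i ^+ 2 * a j ^+ 2.
  rewrite -sumrMnl -sumrB -big_split/=; apply: eq_bigr => i _.
  rewrite -sumrMnl -sumrB -big_split/=; apply: eq_bigr => j _.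
  by ring.
rewrite -!big_distrlr/=; nra.
Qed.

Definition sqn m (v : 'cV[R]_m) : R := \sum_k v k 0 ^+ 2.

Lemma sqn_ge0 m (v : 'cV[R]_m) : 0 <= sqn v.
Proof. by apply: sumr_ge0 => k _; exact: sqr_ge0. Qed.

Lemma l2norm_sqr m (v : 'cV[R]_m) : l2norm v ^+ 2 = sqn v.
Proof. by rewrite sqr_sqrtr// sqn_ge0. Qed.

Lemma sqnZ m (a : R) (v : 'cV[R]_m) : sqn (a *: v) = a ^+ 2 * sqn v.
Proof. by rewrite mulr_sumr; apply: eq_bigr => k _; rewrite mxE exprMn. Qed.

Lemma sqn_eq0 m (v : 'cV[R]_m) : sqn v = 0 -> v = 0.
Proof.
move=> v0; apply/colP => k; rewrite mxE; apply/eqP; rewrite -sqrf_eq0.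
by apply/eqP; apply: (psumr_eq0P _ v0) => // i _; exact: sqr_ge0.
Qed.

Lemma sqnD_le m (u v : 'cV[R]_m) : sqn (u + v) <= 2 * sqn u + 2 * sqn v.
Proof.
rewrite !mulr_sumr -big_split/=; apply: ler_sum => k _; rewrite mxE.
by have := sqr_ge0 (u k 0 - v k 0); nra.
Qed.

Definition dotp m (u v : 'cV[R]_m) : R := \sum_k u k 0 * v k 0.

Lemma dotp_tr m p (M : 'M[R]_(m, p)) (u : 'cV[R]_p) (v : 'cV[R]_m) :
  dotp u (M^T *m v) = dotp (M *m u) v.
Proof.
rewrite /dotp; under eq_bigr do rewrite mxE mulr_sumr.
rewrite exchange_big/=; apply: eq_bigr => l _.
by rewrite mxE mulr_suml; apply: eq_bigr => k _; rewrite mxE; ring.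
Qed.

Lemma dotp_sqr_le m (u v : 'cV[R]_m) : dotp u v ^+ 2 <= sqn u * sqn v.
Proof. exact: cauchy_schwarz_sum. Qed.

Lemma supp_notin p (S : {set 'I_p}) (v : 'cV[R]_p) k :
  supp v \subset S -> k \notin S -> v k 0 = 0.
Proof.
move=> /fintype.subsetP vS kS; apply/eqP; apply: contraNT kS => vk.
by apply: vS; rewrite inE.
Qed.

Lemma sum_supp p (S : {set 'I_p}) (u v : 'cV[R]_p) : supp u \subset S ->
  \sum_(k in S) u k 0 * v k 0 = dotp u v.
Proof.
move=> uS; rewrite big_mkcond/=; apply: eq_bigr => k _.
by case: ifPn => // /(supp_notin uS) ->; rewrite mul0r.
Qed.

End squared_norm.

(** * Oracle least squares and restricted distortion *)

Section oracle_least_squares.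
Context {R : realType} {n p : nat}.
Variables (S : {set 'I_p}) (M : 'M[R]_(n, p)) (y : 'cV[R]_n).

Lemma cols_mulmx : M *m cols S 1%:M = cols S M.
Proof.
apply/matrixP => l i; rewrite !mxE (bigD1 (enum_val i))//= !mxE eqxx mulr1.
rewrite big1 ?addr0// => k ki; rewrite !mxE (negbTE ki) mulr0//.
Qed.

Lemma supp_ols : supp (ols S M y) \subset S.
Proof.
apply/fintype.subsetP => k; rewrite inE; apply: contraNT => kS.
rewrite /ols -mulmxA mxE big1// => i _; rewrite !mxE.
case: eqP => [ki|]; last by rewrite mul0r.
by move: kS; rewrite ki enum_valP.
Qed.

(** With [X] the pseudo-inverse of [M_S], the symmetry of [M_S X] turns
    [M_S^T (M_S X)] into [(M_S X M_S)^T = M_S^T], so that [M_S^T] annihilates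
    the residual even when [M_S] is rank deficient. *)
Lemma ols_normal_equation k : k \in S -> (M^T *m (y - M *m ols S M y)) k 0 = 0.
Proof.
move=> kS; set X := moore_penrose (cols S M).
have [h _ hs _] := moore_penroseP (cols S M).
have e : (cols S M)^T *m (y - M *m ols S M y) = 0.
  have hT : (cols S M)^T *m (cols S M *m X) = (cols S M)^T.
    by rewrite -hs -trmx_mul h.
  rewrite /ols mulmxBr (mulmxA M) (mulmxA M) cols_mulmx.
  by rewrite (mulmxA _ _ y) hT subrr.
have <- : ((cols S M)^T *m (y - M *m ols S M y)) (enum_rank_in kS k) 0 = 0.
  by rewrite e mxE.
rewrite [LHS]mxE [RHS]mxE; apply: eq_bigr => l _; congr (_ * _).
by rewrite !mxE enum_rankK_in.
Qed.

(** By the normal equation, [u := M_S^T (y - M x)] equals [M_S^T M z] for the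
    error [z], so that [<v, u> = <M v, M z>] for all [v] supported in [S].
    Taking [v = z] gives [alpha |z|^2 <= |z| |u|], and taking [v = u] gives
    [|u|^2 <= |M u| |M z| <= beta |u| |z|]. *)
Lemma ols_error_bounds (x : 'cV[R]_p) (alpha beta : R) :
  0 < alpha -> 0 < beta -> supp x \subset S ->
  (forall v : 'cV[R]_p, supp v \subset S ->
     alpha * sqn v <= sqn (M *m v) <= beta * sqn v) ->
  let Q := \sum_(k in S) (M^T *m (y - M *m x)) k 0 ^+ 2 in
  let err := sqn (ols S M y - x) in
  beta ^- 2 * Q <= err /\ err <= alpha ^- 2 * Q.
Proof.
move=> a0 b0 xS riesz Q err.
set z := ols S M y - x.
pose u : 'cV[R]_p := \col_k (if k \in S then (M^T *m (y - M *m x)) k 0 else 0).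
have zS : supp z \subset S.
  apply/fintype.subsetP => k; rewrite inE; apply: contraNT => kS.
  have -> : z k 0 = ols S M y k 0 - x k 0.
    by rewrite [LHS]mxE; congr (_ + _); rewrite mxE.
  by rewrite (supp_notin supp_ols kS) (supp_notin xS kS) subr0.
have uS : supp u \subset S.
  by apply/fintype.subsetP => k; rewrite inE [u k 0]mxE; case: ifP; rewrite ?eqxx.
have QE : Q = sqn u.
  rewrite /Q /sqn big_mkcond/=; apply: eq_bigr => k _; rewrite [u k 0]mxE.
  by case: ifP => // _; rewrite expr0n.
have uE k : k \in S -> u k 0 = (M^T *m (M *m z)) k 0.
  move=> kS; rewrite [LHS]mxE kS.
  have -> : y - M *m x = (y - M *m ols S M y) + M *m z.
    by rewrite mulmxBr addrA subrK.
  by rewrite mulmxDr [LHS]mxE ols_normal_equation// add0r.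
have dotE v : supp v \subset S -> dotp v u = dotp (M *m v) (M *m z).
  move=> vS; rewrite -dotp_tr -!(sum_supp _ vS).
  by apply: eq_bigr => k kS; rewrite uE.
have /andP[za zb] := riesz _ zS; have /andP[_ ub] := riesz _ uS.
have zz : sqn (M *m z) = dotp z u.
  by rewrite dotE//; apply: eq_bigr => l _; rewrite expr2.
have uu : sqn u = dotp (M *m u) (M *m z).
  by rewrite -dotE//; apply: eq_bigr => l _; rewrite expr2.
have z0 := sqn_ge0 z; have u0 := sqn_ge0 u.
rewrite QE -/err; have -> : err = sqn z by [].
split.
- rewrite ler_pdivrMl ?exprn_gt0//.
  have := dotp_sqr_le (M *m u) (M *m z); rewrite -uu => h.
  have h2 : sqn u ^+ 2 <= (beta * sqn u) * (beta * sqn z).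
    by apply: (le_trans h); apply: ler_pM; rewrite ?sqn_ge0.
  move: u0; rewrite le0r => /predU1P[->|u0]; first by rewrite mulr_ge0// sqr_ge0.
  by rewrite -(ler_pM2l u0); nra.
- rewrite ler_pdivlMl ?exprn_gt0//.
  have := dotp_sqr_le z u; rewrite -zz => h.
  have h2 : (alpha * sqn z) ^+ 2 <= sqn z * sqn u.
    by apply: le_trans h; rewrite ler_sqr ?nnegrE ?mulr_ge0 ?sqn_ge0// ltW.
  move: z0; rewrite le0r => /predU1P[->|z0]; first by rewrite mulr0.
  by rewrite -(ler_pM2l z0); nra.
Qed.

End oracle_least_squares.

(** * From a finite grid to all vectors supported in [S] *)

Section grid.
Context {R : realType} {n p : nat}.
Implicit Types (S : {set 'I_p}) (M : 'M[R]_(n, p)) (v e : 'cV[R]_p) (m : nat).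

(** Codes in [0, 2m] stand for the integers between [- m] and [m], so that the
    grid is indexed by a finite type. *)
Definition gridv m (z : {ffun 'I_p -> 'I_(m.*2.+1)}) : 'cV[R]_p :=
  \col_k ((z k)%:R - m%:R).

Lemma gridv_eq0 m (z : {ffun 'I_p -> 'I_(m.*2.+1)}) k :
  (gridv z k 0 == 0) = (z k == inord m).
Proof.
rewrite mxE subr_eq0 eqr_nat; apply/eqP/eqP => [e|->].
  by apply: val_inj; rewrite /= inordK// ltnS -addnn leq_addr.
by rewrite inordK// ltnS -addnn leq_addr.
Qed.

Lemma card_gridv m S :
  (#|[pred z : {ffun 'I_p -> 'I_(m.*2.+1)} | supp (gridv z) \subset S]|
    <= m.*2.+1 ^ #|S|)%N.
Proof.
rewrite -[X in (X ^ _)%N]card_ord -(card_pffun_on (inord m) S).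
apply/subset_leq_card/fintype.subsetP => z; rewrite inE => /fintype.subsetP zS.
apply/pffun_onP; split => //; apply/fintype.subsetP => k; rewrite inE => zk.
by apply: zS; rewrite inE gridv_eq0.
Qed.

Lemma gridv_round m S v : supp v \subset S -> (forall k, `|v k 0| <= m%:R) ->
  exists2 z : {ffun 'I_p -> 'I_(m.*2.+1)}, supp (gridv z) \subset S &
    forall k, `|v k 0 - gridv z k 0| <= 1.
Proof.
move=> vS vm.
pose z : {ffun 'I_p -> 'I_(m.*2.+1)} :=
  [ffun k => inord (Num.truncn (v k 0 + m%:R))].
have zE k : z k = Num.truncn (v k 0 + m%:R) :> nat.
  have := vm k; rewrite ler_norml => /andP[_ vk].
  rewrite ffunE inordK// ltnS truncn_le_nat -natr1 -addnn natrD.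
  by rewrite -addrA ler_ltD// ltrDl.
exists z => [|k].
  apply/fintype.subsetP => k; rewrite inE; apply: contraNT => kS.
  rewrite gridv_eq0; apply/eqP/val_inj; rewrite /= zE (supp_notin vS kS) add0r.
  by rewrite natrK inordK// ltnS -addnn leq_addr.
have := vm k; rewrite ler_norml => /andP[vk _].
have /truncn_itv : 0 <= v k 0 + m%:R by lra.
rewrite -zE mxE -natr1 => /andP[h1 h2].
by rewrite ler_norml; apply/andP; split; lra.
Qed.

(** The operator norm on vectors supported in [S] is at most the Frobenius norm
    of the columns in [S]. *)
Lemma sqn_mulmx_le S M e : supp e \subset S ->
  sqn (M *m e) <= (\sum_(k in S) sqn (col k M)) * sqn e.
Proof.
move=> eS; rewrite exchange_big/= mulr_suml; apply: ler_sum => l _.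
have -> : (M *m e) l 0 = \sum_(k in S) M l k * e k 0.
  rewrite mxE [RHS]big_mkcond/=; apply: eq_bigr => k _.
  by case: ifPn => // /(supp_notin eS) ->; rewrite mulr0.
apply: (le_trans (cauchy_schwarz_sum _ _ _ _)).
under eq_bigr do rewrite mxE; apply: ler_wpM2l.
  by apply: sumr_ge0 => k _; exact: sqr_ge0.
rewrite [leRHS](bigID (mem S))/= lerDl sumr_ge0// => k _; exact: sqr_ge0.
Qed.

(** Rescale [v] to [y] with [|y| = m = 8 s] and round it to a grid point [g].
    The rounding error [e] has [|e|^2 <= s], while the columns of [M] in [S]
    are images of grid points, so [|M e|^2 <= 3/2 s |e|^2 <= 3/2 s^2] is a
    small fraction of [|y|^2 = 64 s^2].  The constants [1/16] and [7] leave
    room for the loss of [|a + b|^2 <= 2 |a|^2 + 2 |b|^2]. *)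
Lemma riesz_of_grid m S M : (0 < #|S|)%N -> m = (8 * #|S|)%N ->
  (forall z : {ffun 'I_p -> 'I_(m.*2.+1)}, supp (gridv z) \subset S ->
     2^-1 * sqn (gridv z) <= sqn (M *m gridv z) <= 3 / 2 * sqn (gridv z)) ->
  forall v, supp v \subset S ->
    16^-1 * sqn v <= sqn (M *m v) <= 7 * sqn v.
Proof.
move=> S0 mE hz v vS; set s : R := #|S|%:R.
have s0 : 1 <= s by rewrite ler1n.
have ms : m%:R = 8 * s :> R by rewrite mE natrM.
have colk k : k \in S -> sqn (col k M) <= 3 / 2.
  move=> kS; pose z : {ffun 'I_p -> 'I_(m.*2.+1)} :=
    [ffun j => inord (m + (j == k))].
  have zE : gridv z = delta_mx k 0.
    apply/colP => j; rewrite !mxE ffunE inordK ?eqxx ?andbT.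
      by rewrite natrD addrC addKr.
    rewrite ltnS -addnn leq_add2l mE; case: (j == k) => //.
    by rewrite muln_gt0.
  have zS : supp (gridv z) \subset S.
    apply/fintype.subsetP => j; rewrite zE inE mxE eqxx andbT.
    by case: (eqVneq j k) => [->//|]; rewrite eqxx.
  have /andP[_] := hz z zS; rewrite zE -colE.
  have -> : sqn (delta_mx k 0 : 'cV[R]_p) = 1.
    rewrite /sqn (bigD1 k)//= mxE !eqxx expr1n big1 ?addr0// => j jk.
    by rewrite mxE (negbTE jk) expr0n.
  by rewrite mulr1.
have frob e : supp e \subset S -> sqn (M *m e) <= 3 / 2 * s * sqn e.
  move=> eS; apply: (le_trans (sqn_mulmx_le _ eS)).
  apply: ler_wpM2r; first exact: sqn_ge0.
  apply: (@le_trans _ _ (\sum_(k in S) (3 / 2))).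
    by apply: ler_sum => i iS; exact: colk.
  by rewrite sumr_const /s mulr_natr.
have [v0|v0] := eqVneq (sqn v) 0.
  by rewrite (sqn_eq0 v0) mulmx0 /sqn !big1 ?mulr0 ?lexx// => i _;
    rewrite mxE expr0n.
have {}v0 : 0 < sqn v by rewrite lt_def v0 sqn_ge0.
pose a := m%:R / Num.sqrt (sqn v); pose y := a *: v.
have a0 : 0 < a.
  by rewrite divr_gt0// ?sqrtr_gt0// ms; lra.
have yE : sqn y = 64 * s ^+ 2.
  rewrite sqnZ exprMn exprVn sqr_sqrtr ?sqn_ge0// ms.
  by rewrite -mulrA mulVf ?gt_eqF// mulr1; ring.
have yS : supp y \subset S.
  apply/fintype.subsetP => k; rewrite inE; apply: contraNT => kS.
  by rewrite mxE (supp_notin vS kS) mulr0.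
have ym k : `|y k 0| <= m%:R.
  rewrite -(@ler_pXn2r _ 2)// ?nnegrE//.
  have -> : m%:R ^+ 2 = sqn y by rewrite yE ms; ring.
  rewrite real_normK ?num_real// /sqn (bigD1 k)//= lerDl sumr_ge0// => j _.
  exact: sqr_ge0.
have [z zS yz] := gridv_round yS ym.
set g := gridv z in zS yz; pose e := y - g.
have eS : supp e \subset S.
  apply/fintype.subsetP => k; rewrite inE; apply: contraNT => kS.
  have -> : e k 0 = y k 0 - g k 0 by rewrite [LHS]mxE; congr (_ + _); rewrite mxE.
  by rewrite (supp_notin yS kS) (supp_notin zS kS) subr0.
have es : sqn e <= s.
  rewrite /sqn (bigID (mem S))/= [X in _ + X]big1 ?addr0 => [|k kS]; last first.
    by rewrite (supp_notin eS kS) expr0n.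
  apply: (@le_trans _ _ (\sum_(k in S) 1)); last by rewrite sumr_const.
  apply: ler_sum => k _; have := yz k.
  have -> : e k 0 = y k 0 - g k 0 by rewrite [LHS]mxE; congr (_ + _); rewrite mxE.
  by rewrite -real_normK ?num_real// => h; rewrite expr_le1.
have e0 := sqn_ge0 e; have g0 := sqn_ge0 g.
have Me : sqn (M *m e) <= 3 / 2 * s ^+ 2.
  by apply: (le_trans (frob _ eS)); nra.
have /andP[lg ug] := hz z zS; rewrite -/g in lg ug.
have yge : y = g + e by rewrite addrC subrK.
have gye : g = y + -1 *: e by rewrite yge scaleN1r addrK.
have h1 : sqn y <= 2 * sqn g + 2 * sqn e by rewrite {1}yge sqnD_le.
have h2 : sqn g <= 2 * sqn y + 2 * sqn e.
  by rewrite {1}gye (le_trans (sqnD_le _ _))// (sqnZ (-1)) sqrrN expr1n mul1r.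
have h3 : sqn (M *m y) <= 2 * sqn (M *m g) + 2 * sqn (M *m e).
  by rewrite {1}yge mulmxDr sqnD_le.
have h4 : sqn (M *m g) <= 2 * sqn (M *m y) + 2 * sqn (M *m e).
  rewrite {1}gye mulmxDr -(scalemxAr (-1)) (le_trans (sqnD_le _ _))//.
  by rewrite (sqnZ (-1)) sqrrN expr1n mul1r.
have main : 16^-1 * sqn y <= sqn (M *m y) <= 7 * sqn y.
  by rewrite yE in h1 h2 *; apply/andP; split; nra.
move: main; rewrite -scalemxAr !sqnZ !(mulrCA _ (a ^+ 2)).
by rewrite !ler_pM2l// exprn_gt0.
Qed.

End grid.

(** * Inequalities for the exponential *)

Section exponential_bounds.
Context {R : realType}.
Implicit Types (x y w : R).

Lemma expR_le_quadratic x : x <= 2^-1 -> expR x <= 1 + x + 2 * x ^+ 2.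
Proof.
move=> x2; have h : 1 - x <= (expR x)^-1 by rewrite -expRN expR_ge1Dx.
have e0 := expR_gt0 x.
have h2 : (1 - x) * expR x <= 1 by rewrite -ler_pdivlMr// div1r.
have x1 : 0 < 1 - x by lra.
rewrite -(ler_pM2l x1) (le_trans h2)//.
have := sqr_ge0 x; nra.
Qed.

(** This bounds the moment generating function of a centred variable: the
    linear term disappears in expectation and leaves a subgaussian bound. *)
Lemma expR_le_sub x : expR x <= x + expR (2 * x ^+ 2).
Proof.
have [x2|x2] := leP x 2^-1.
  have := expR_le_quadratic x2; have := expR_ge1Dx (2 * x ^+ 2); lra.
have : expR x <= expR (2 * x ^+ 2) by rewrite ler_expR; nra.
lra.
Qed.

Lemma expR_le_taylor2 y : expR y <= 1 + y + 4 * y ^+ 2 * expR `|y|.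
Proof.
have y2 := sqr_ge0 y.
have [h|h] := leP y 2^-1.
  have := expR_le_quadratic h.
  have : 1 <= expR `|y| by rewrite -expR0 ler_expR.
  nra.
rewrite ger0_norm; last by lra.
have e0 := expR_gt0 y; have h4 : 1 <= 4 * y ^+ 2 by nra.
have : expR y <= 4 * y ^+ 2 * expR y by rewrite ler_peMl// ltW.
lra.
Qed.

Lemma sqr_le_expR y : 0 <= y -> y ^+ 2 <= 4 * expR y.
Proof.
move=> y0; have h := expR_ge1Dx (y / 2).
have -> : expR y = expR (y / 2) ^+ 2 by rewrite -expRM_natl; congr expR; lra.
nra.
Qed.

(** A discrete substitute for the Gaussian identity that writes [exp(c w^2)] as
    an average of [exp(t w)] over a normal variable [t]: restricting [t] to
    integers keeps expectations finite sums, and the single term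
    [j = floor(|w| / 6)] already dominates the left-hand side.  The weights
    [exp(- 3 j^2)] beat the growth [exp(2 j^2)] of the moment generating
    functions to which the bound is applied. *)
Lemma expR_sqr_le_sum (J : nat) w : `|w| <= 6 * J%:R ->
  expR (w ^+ 2 / 24) <= expR (3 / 2) *
    \sum_(j < J.+1) expR (- (3 * j%:R ^+ 2)) *
      (expR (j%:R * w) + expR (- (j%:R) * w)).
Proof.
have [a aE] : exists a : R, a = `|w| by exists `|w|.
rewrite -aE => wJ; have a0 : 0 <= a by rewrite aE.
have /truncn_itv : 0 <= a / 6 by lra.
set j := Num.truncn _ => /andP[j1 j2].
have jJ : (j < J.+1)%N.
  by rewrite ltnS -(@ler_nat R) (le_trans j1)// ler_pdivrMr// mulrC.
rewrite (bigD1 (Ordinal jJ))//= mulrDr; apply: ler_wpDr.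
  apply: mulr_ge0; first exact: expR_ge0.
  apply: sumr_ge0 => i _; apply: mulr_ge0; first exact: expR_ge0.
  by apply: addr_ge0; exact: expR_ge0.
rewrite mulrA -expRD.
apply: (@le_trans _ _ (expR (3 / 2 - 3 * j%:R ^+ 2) * expR (j%:R * a))).
  have -> : w ^+ 2 = a ^+ 2 by rewrite aE real_normK ?num_real.
  rewrite -expRD ler_expR; rewrite -[j.+1%:R]natr1 in j2.
  have j0 : 0 <= j%:R :> R by [].
  have h1 : 0 <= j%:R * (a / 6 - j%:R) by rewrite mulr_ge0// subr_ge0.
  have h2 : (a / 6 - j%:R) ^+ 2 <= 1.
    rewrite expr_le1 ?subr_ge0//.
    lra.
  nra.
rewrite ler_wpM2l ?expR_ge0//.
have [w0|w0] := leP 0 w; rewrite aE.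
  by rewrite ger0_norm// lerDl expR_ge0.
by rewrite ltr0_norm// mulrN mulNr lerDr expR_ge0.
Qed.

Lemma expRN1_le_half : expR (- 1) <= 2^-1 :> R.
Proof.
rewrite expRN lef_pV2 ?posrE ?expR_gt0//.
have := @expR_ge1Dx R 1; lra.
Qed.

Lemma sum_expRN_sqr_le2 (J : nat) : \sum_(j < J) expR (- (j%:R ^+ 2)) <= 2 :> R.
Proof.
apply: (@le_trans _ _ (\sum_(j < J) 2^-1 ^+ j)).
  apply: ler_sum => j _.
  apply: (@le_trans _ _ (expR (- 1) ^+ j)); last first.
    by rewrite lerXn2r ?nnegrE ?expR_ge0// expRN1_le_half.
  rewrite -expRM_natl ler_expR mulrN1 lerN2.
  by rewrite -natrX ler_nat; case: (j : nat) => // i; rewrite -mulnn leq_pmulr.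
suff -> : \sum_(j < J) 2^-1 ^+ j = 2 - 2 * 2^-1 ^+ J :> R.
  by rewrite gerBl mulr_ge0.
elim: J => [|J IH]; first by rewrite big_ord0 expr0 mulr1 subrr.
by rewrite big_ord_recr/= IH exprS; lra.
Qed.

End exponential_bounds.

(** * Expectations on finite product spaces *)

Section finite_expectation.
Context {R : realType}.
Implicit Types (I J : finType).

Definition fexp J (w f : J -> R) : R := \sum_j w j * f j.

Definition is_dist J (w : J -> R) := (forall j, 0 <= w j) /\ \sum_j w j = 1.

Definition prodw I J (w : J -> R) (f : {ffun I -> J}) : R := \prod_i w (f i).

Lemma le_fexp J (w f g : J -> R) : is_dist w -> (forall j, f j <= g j) ->
  fexp w f <= fexp w g.
Proof. by move=> [w0 _] fg; apply: ler_sum => j _; exact: ler_wpM2l. Qed.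

Lemma fexpD J (w f g : J -> R) :
  fexp w (fun j => f j + g j) = fexp w f + fexp w g.
Proof. by rewrite /fexp -big_split/=; apply: eq_bigr => j _; rewrite mulrDr. Qed.

Lemma fexpZ J (w f : J -> R) (a : R) :
  fexp w (fun j => a * f j) = a * fexp w f.
Proof. by rewrite /fexp mulr_sumr; apply: eq_bigr => j _; rewrite mulrCA. Qed.

Lemma fexp_cst J (w : J -> R) (a : R) : is_dist w -> fexp w (fun=> a) = a.
Proof. by move=> [_ w1]; rewrite /fexp -mulr_suml w1 mul1r. Qed.

Lemma fexp_sum J K (w : J -> R) (f : K -> J -> R) (r : seq K) :
  fexp w (fun j => \sum_(i <- r) f i j) = \sum_(i <- r) fexp w (f i).
Proof.
by rewrite /fexp exchange_big/=; apply: eq_bigr => j _; rewrite mulr_sumr.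
Qed.

Lemma fexp_prodw I J (w : J -> R) (F : I -> J -> R) :
  fexp (prodw w) (fun f => \prod_i F i (f i)) = \prod_i fexp w (F i).
Proof.
rewrite /fexp bigA_distr_bigA/=; apply: eq_bigr => f _.
by rewrite -big_split.
Qed.

Lemma is_dist_prodw I J (w : J -> R) : is_dist w -> is_dist (@prodw I J w).
Proof.
move=> dw; have [w0 _] := dw; split=> [f|]; first exact: prodr_ge0.
have : fexp (prodw w) (fun=> \prod_(i : I) 1) = \prod_(i : I) fexp w (fun=> 1) :=
  fexp_prodw w (fun=> fun=> 1).
rewrite big1_eq [RHS]big1 => [<-|i _]; last exact: fexp_cst.
by apply: eq_bigr => f _; rewrite mulr1.
Qed.

Lemma chernoff_bound J (w X : J -> R) (t : R) : is_dist w ->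
  \sum_(j | t <= X j) w j <= fexp w (fun j => expR (X j)) * expR (- t).
Proof.
move=> [w0 _]; rewrite big_mkcond /fexp mulr_suml; apply: ler_sum => j _.
have e0 : 0 <= w j * expR (X j) * expR (- t).
  by rewrite !mulr_ge0 ?expR_ge0.
case: ifPn => // tX; rewrite -mulrA -expRD ler_peMr//.
by rewrite -expR0 ler_expR subr_ge0.
Qed.

Lemma sum_has_le J (w : J -> R) (K : finType) (D : pred K) (B : K -> pred J) :
  (forall j, 0 <= w j) ->
  \sum_(j | [exists i, D i && B i j]) w j <= \sum_(i | D i) \sum_(j | B i j) w j.
Proof.
move=> w0; rewrite (exchange_big_dep predT)//= big_mkcond/=.
apply: ler_sum => j _; case: ifPn => [/existsP[i /andP[Di Bij]]|_].
  by rewrite (bigD1 i)/= ?Di//= lerDl sumr_ge0.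
exact: sumr_ge0.
Qed.

End finite_expectation.

(** * Subgaussian bounds for one row *)

Section bernoulli_row.
Context {R : realType} {p : nat}.
Variable q : R.
Hypothesis q_itv : 0 < q <= 2^-1.

Definition bernw (b : bool) : R := if b then q else 1 - q.

Definition rowform (c : 'cV[R]_p) (b : {ffun 'I_p -> bool}) : R :=
  \sum_k (((b k)%:R - q) * c k 0).

Local Notation roww := (@prodw R 'I_p bool bernw).
Local Notation sigma2 := (q * (1 - q)).

Lemma is_dist_bernw : is_dist bernw.
Proof.
have /andP[q0 q2] := q_itv.
split => [[]|]; rewrite /bernw /=; [exact: ltW|lra|].
by rewrite big_bool/= addrC subrK.
Qed.

Let dist_roww : is_dist roww := is_dist_prodw _ is_dist_bernw.

Lemma fexp_bernw (f : bool -> R) :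
  fexp bernw f = q * f true + (1 - q) * f false.
Proof. by rewrite /fexp big_bool. Qed.

Lemma centered_le1 (b : bool) : `|b%:R - q| <= 1.
Proof.
have /andP[q0 q2] := q_itv.
by rewrite ler_norml; case: b; apply/andP; split; rewrite ?mulr1n ?mulr0n; lra.
Qed.

Lemma bernw_mgf_le t : fexp bernw (fun b : bool => expR ((b%:R - q) * t)) <=
  expR (2 * t ^+ 2).
Proof.
have /andP[q0 q2] := q_itv.
have h (b : bool) : expR ((b%:R - q) * t) <= (b%:R - q) * t + expR (2 * t ^+ 2).
  apply: (le_trans (expR_le_sub _)); rewrite lerD2l ler_expR.
  have t2 := sqr_ge0 t.
  have : (b%:R - q) ^+ 2 <= 1.
    by rewrite -real_normK ?num_real// expr_le1// centered_le1.
  by rewrite exprMn; nra.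
apply: (le_trans (le_fexp is_dist_bernw h)).
rewrite fexpD fexp_cst; last exact: is_dist_bernw.
by rewrite fexp_bernw -[true%:R]/1 -[false%:R]/0; lra.
Qed.

Lemma rowform_mgf_le c t :
  fexp roww (fun b => expR (t * rowform c b)) <= expR (2 * t ^+ 2 * sqn c).
Proof.
have e b : expR (t * rowform c b) = \prod_k expR (((b k)%:R - q) * (t * c k 0)).
  rewrite -expR_sum; congr expR; rewrite mulr_sumr.
  by apply: eq_bigr => k _; rewrite mulrCA.
rewrite /fexp; under eq_bigr do rewrite e; rewrite -/(fexp _ _).
rewrite (fexp_prodw bernw (fun k x => expR ((x%:R - q) * (t * c k 0)))).
rewrite mulr_sumr expR_sum; apply: ler_prod => k _; apply/andP; split.
  apply: sumr_ge0 => x _; rewrite mulr_ge0 ?expR_ge0//.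
  by case: is_dist_bernw.
by apply: (le_trans (bernw_mgf_le _)); rewrite exprMn mulrA.
Qed.

Definition subgauss_const : R := 4 * expR (3 / 2).

(** After averaging, the term of index [j] in [expR_sqr_le_sum] is at most
    [2 exp(- 3 j^2 + 2 j^2)], which is summable. *)
Lemma rowform_expR_sqr_le c : sqn c = 1 ->
  fexp roww (fun b => expR (rowform c b ^+ 2 / 24)) <= subgauss_const.
Proof.
have /andP[q0 q2] := q_itv.
move=> c1.
(* [J] makes all integers up to [|W| / 6] available for every outcome; the
   final bound is uniform in it. *)
pose J := (Num.truncn (\sum_k `|c k 0|)).+1.
have wJ b : `|rowform c b| <= 6 * J%:R.
  apply: (@le_trans _ _ (\sum_k `|c k 0|)).
    apply: (le_trans (ler_norm_sum _ _ _)); apply: ler_sum => k _.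
    by rewrite normrM ler_piMl// centered_le1.
  have := ltW (truncnS_gt (\sum_k `|c k 0|)); rewrite -/J => h.
  have : 0 <= J%:R :> R by []; lra.
apply: (le_trans (le_fexp dist_roww (fun b => expR_sqr_le_sum (wJ b)))).
rewrite fexpZ fexp_sum /subgauss_const mulrC ler_wpM2r ?expR_ge0//.
apply: (@le_trans _ _ (\sum_(j < J.+1) 2 * expR (- (j%:R ^+ 2)))).
  apply: ler_sum => j _; rewrite fexpZ fexpD.
  have h1 := rowform_mgf_le c j%:R; have h2 := rowform_mgf_le c (- j%:R).
  rewrite c1 mulr1 in h1; rewrite c1 mulr1 sqrrN in h2.
  apply: (@le_trans _ _ (expR (- (3 * j%:R ^+ 2)) * (2 * expR (2 * j%:R ^+ 2)))).
    by rewrite ler_wpM2l ?expR_ge0//; lra.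
  rewrite mulrCA -expRD ler_wpM2l// ler_expR; lra.
by rewrite -mulr_sumr; have := @sum_expRN_sqr_le2 R J.+1; lra.
Qed.

Lemma fexp_roww_cov (k k' : 'I_p) :
  fexp roww (fun b => ((b k)%:R - q) * ((b k')%:R - q)) =
  if k == k' then sigma2 else 0.
Proof.
pose F (i : 'I_p) (x : bool) : R := (if i == k then x%:R - q else 1) *
  (if i == k' then x%:R - q else 1).
have e (b : {ffun 'I_p -> bool}) : ((b k)%:R - q) * ((b k')%:R - q) = \prod_i F i (b i).
  by rewrite big_split/= -!big_mkcond/= !big_pred1_eq.
rewrite /fexp; under eq_bigr do rewrite e; rewrite -/(fexp _ _) fexp_prodw.
rewrite (bigD1 k)//= fexp_bernw /F eqxx -[true%:R]/1 -[false%:R]/0.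
case: eqVneq => [<-{k' e F}|kk'].
  rewrite big1 => [|i ik]; first by ring.
  by rewrite fexp_bernw (negbTE ik); ring.
by rewrite (_ : q * _ + _ = 0) ?mul0r//; ring.
Qed.

Lemma fexp_rowform_sqr c : fexp roww (fun b => rowform c b ^+ 2) = sigma2 * sqn c.
Proof.
have e b : rowform c b ^+ 2 = \sum_k \sum_k' (c k 0 * c k' 0) *
    (((b k)%:R - q) * ((b k')%:R - q)).
  rewrite expr2 big_distrlr/=; apply: eq_bigr => k _; apply: eq_bigr => k' _.
  by ring.
rewrite /fexp; under eq_bigr do rewrite e; rewrite -/(fexp _ _).
rewrite fexp_sum mulr_sumr; apply: eq_bigr => k _.
rewrite fexp_sum (bigD1 k)//= big1 ?addr0 => [|k' k'k].
  by rewrite fexpZ fexp_roww_cov eqxx mulrC expr2.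
by rewrite fexpZ fexp_roww_cov eq_sym (negbTE k'k) mulr0.
Qed.

Definition bernstein_const : R := 16 * 48 ^+ 2 * subgauss_const.

Lemma bernstein_const_gt0 : 0 < bernstein_const.
Proof.
by rewrite /bernstein_const /subgauss_const !mulr_gt0 ?exprn_gt0 ?expR_gt0.
Qed.

(** The first order term is exact, which is what makes both tails available at
    the true mean [q (1 - q)] although the form is only subgaussian with an
    absolute constant, independent of [q].  In the second order remainder,
    [W^4] and [exp(|lam| W^2)] are each absorbed by a factor
    [exp(W^2 / 48)]. *)
Lemma rowform_sqr_mgf_le c lam : sqn c = 1 -> `|lam| <= 48^-1 ->
  fexp roww (fun b => expR (lam * rowform c b ^+ 2)) <=
  expR (lam * sigma2 + bernstein_const * lam ^+ 2).
Proof.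
move=> c1 lam48.
have h b : expR (lam * rowform c b ^+ 2) <=
    1 + (lam * rowform c b ^+ 2 +
    16 * 48 ^+ 2 * lam ^+ 2 * expR (rowform c b ^+ 2 / 24)).
  move: (rowform c b ^+ 2) (sqr_ge0 (rowform c b)) => v v0.
  apply: (le_trans (expR_le_taylor2 _)); rewrite addrA lerD2l.
  have -> : v / 24 = v / 48 + v / 48 by lra.
  have h1 : v ^+ 2 <= 48 ^+ 2 * (4 * expR (v / 48)).
    have -> : v ^+ 2 = 48 ^+ 2 * (v / 48) ^+ 2 by field.
    by apply: ler_wpM2l => //; apply: sqr_le_expR; exact: divr_ge0.
  have h2 : expR `|lam * v| <= expR (v / 48).
    by rewrite ler_expR normrM (ger0_norm v0) [leRHS]mulrC; apply: ler_wpM2r.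
  have -> : 16 * 48 ^+ 2 * lam ^+ 2 * expR (v / 48 + v / 48) =
    4 * lam ^+ 2 * ((48 ^+ 2 * (4 * expR (v / 48))) * expR (v / 48)).
    by rewrite expRD; ring.
  have -> : 4 * (lam * v) ^+ 2 * expR `|lam * v| =
    4 * lam ^+ 2 * (v ^+ 2 * expR `|lam * v|) by ring.
  apply: ler_wpM2l.
    by apply: mulr_ge0 => //; exact: sqr_ge0.
  by apply: ler_pM => //; rewrite ?sqr_ge0 ?expR_ge0.
apply: (le_trans (le_fexp dist_roww h)).
rewrite fexpD fexp_cst// fexpD !fexpZ fexp_rowform_sqr c1 mulr1.
apply: le_trans (expR_ge1Dx _); rewrite lerD2l lerD2l /bernstein_const.
have := rowform_expR_sqr_le c1; have := sqr_ge0 lam; nra.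
Qed.

End bernoulli_row.

(** * Concentration of the energy of one vector *)

Section bernoulli_matrix.
Context {R : realType} {n p : nat}.
Variable q : R.
Hypothesis q_itv : 0 < q <= 2^-1.

Definition matw (a : {ffun 'I_n -> {ffun 'I_p -> bool}}) : R :=
  prodw (prodw (bernw q)) a.

Lemma is_dist_matw : is_dist matw.
Proof. exact/is_dist_prodw/is_dist_prodw/is_dist_bernw. Qed.

Definition energy (c : 'cV[R]_p) (a : {ffun 'I_n -> {ffun 'I_p -> bool}}) : R :=
  \sum_l rowform q c (a l) ^+ 2.

Let sigma2 := q * (1 - q).
Let D := @bernstein_const R.

Lemma energy_mgf_le c lam : sqn c = 1 -> `|lam| <= 48^-1 ->
  fexp matw (fun a => expR (lam * energy c a)) <=
  expR (n%:R * (lam * sigma2 + D * lam ^+ 2)).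
Proof.
move=> c1 lam48; rewrite /fexp.
under eq_bigr do rewrite /energy mulr_sumr expR_sum.
rewrite -/(fexp _ _) (fexp_prodw (prodw (bernw q))
  (fun=> fun b => expR (lam * rowform q c b ^+ 2))).
rewrite prodr_const card_ord expRM_natl lerXn2r ?nnegrE ?expR_ge0//.
  apply: sumr_ge0 => b _; rewrite mulr_ge0 ?expR_ge0//.
  by case: (is_dist_prodw 'I_p (is_dist_bernw q_itv)).
exact: rowform_sqr_mgf_le.
Qed.

(** Chernoff's bound for both tails, with [lam = q (1 - q) / (4 D)] minimizing
    the exponent [n (D lam^2 - lam q (1 - q) / 2)]; its minimum is
    [- n (q (1 - q))^2 / (16 D)], and [1 - q >= 1/2]. *)
Lemma energy_deviation_unit c : sqn c = 1 ->
  \sum_(a | n%:R * sigma2 / 2 < `|energy c a - n%:R * sigma2|) matw a <=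
  2 * expR (- (n%:R * q ^+ 2 / (64 * D))).
Proof.
move=> c1; have [w0 _] := is_dist_matw; have /andP[q0 q2] := q_itv.
have D1 : 16 * 48 ^+ 2 <= D.
  rewrite /D /bernstein_const ler_peMr// /subgauss_const.
  by have := @expR_ge1Dx R (3 / 2); lra.
have D0 : 0 < D by apply: lt_le_trans D1.
have s0 : 0 < sigma2 by rewrite /sigma2 mulr_gt0//; lra.
have s1 : sigma2 <= 1 by rewrite /sigma2; nra.
pose lam := sigma2 / (4 * D).
have lam0 : 0 <= lam by rewrite divr_ge0 ?(ltW s0)// mulr_ge0// ltW.
have lam48 : lam <= 48^-1.
  by rewrite ler_pdivrMr ?mulr_gt0// (le_trans s1)//; lra.
have final : - lam * (n%:R * sigma2 / 2) + n%:R * (D * lam ^+ 2) <=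
    - (n%:R * q ^+ 2 / (64 * D)).
  have -> : - lam * (n%:R * sigma2 / 2) + n%:R * (D * lam ^+ 2) =
      - (n%:R * sigma2 ^+ 2 / (16 * D)).
    by rewrite /lam; field; rewrite gt_eqF.
  rewrite lerN2.
  have -> : n%:R * q ^+ 2 / (64 * D) = n%:R * (q ^+ 2 / 4) / (16 * D).
    by field; rewrite gt_eqF.
  rewrite ler_wpM2r ?invr_ge0 ?mulr_ge0 ?(ltW D0)//.
  by rewrite ler_wpM2l// /sigma2 exprMn ler_wpM2l ?sqr_ge0//; nra.
have tail eps : `|eps| = 1 ->
    \sum_(a | n%:R * sigma2 / 2 <= eps * (energy c a - n%:R * sigma2)) matw a
    <= expR (- (n%:R * q ^+ 2 / (64 * D))).
  move=> eps1.
  have el : `|eps * lam| <= 48^-1 by rewrite normrM eps1 mul1r ger0_norm.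
  have eps2 : eps ^+ 2 = 1 by rewrite -real_normK ?num_real// eps1 expr1n.
  apply: (@le_trans _ _ (\sum_(a | lam * (n%:R * sigma2 / 2) +
      eps * lam * (n%:R * sigma2) <= eps * lam * energy c a) matw a)).
    rewrite big_mkcond [leRHS]big_mkcond; apply: ler_sum => a _.
    case: ifPn => [h|_]; last by case: ifP.
    by rewrite ifT//; have := ler_wpM2l lam0 h; lra.
  apply: (le_trans (chernoff_bound _ _ is_dist_matw)).
  apply: (le_trans (ler_wpM2r (expR_ge0 _) (energy_mgf_le c1 el))).
  rewrite -expRD ler_expR; apply: le_trans final.
  by rewrite exprMn eps2; lra.
have tp := tail 1 (normr1 _); have tm := tail (-1) (normrN1 _).
rewrite [leRHS]mulr_natl mulr2n; apply: le_trans (lerD tp tm).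
rewrite big_mkcond [X in _ <= X + _]big_mkcond [X in _ <= _ + X]big_mkcond.
rewrite -big_split/=; apply: ler_sum => a _.
rewrite mul1r mulN1r; have wa := w0 a.
case: ifPn => [h|_]; case: ifPn => [_|h1]; case: ifPn => [_|h2];
  rewrite ?addr0 ?add0r ?addr_ge0 ?lerDl//.
rewrite -!ltNge in h1 h2; exfalso; move: h; apply/negP; rewrite -leNgt.
by rewrite ler_norml; apply/andP; split; [rewrite lerNl|]; exact: ltW.
Qed.

(** Both sides of the deviation event are quadratic in [c]. *)
Lemma energy_deviation c :
  \sum_(a | n%:R * sigma2 * sqn c / 2 <
            `|energy c a - n%:R * sigma2 * sqn c|) matw a <=
  2 * expR (- (n%:R * q ^+ 2 / (64 * D))).
Proof.
have energyZ t v a : energy (t *: v) a = t ^+ 2 * energy v a.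
  rewrite mulr_sumr; apply: eq_bigr => l _; rewrite -exprMn; congr (_ ^+ 2).
  by rewrite mulr_sumr; apply: eq_bigr => k _; rewrite mxE mulrCA.
have [c0|c0] := eqVneq (sqn c) 0.
  rewrite big1 ?mulr_ge0 ?expR_ge0// => a; rewrite c0 !mulr0 mul0r subr0.
  have := energyZ 0 c a; rewrite (sqn_eq0 c0) scaler0 expr0n mul0r => ->.
  by rewrite normr0 ltxx.
have {}c0 : 0 < sqn c by rewrite lt_def c0 sqn_ge0.
pose u := (Num.sqrt (sqn c))^-1 *: c.
have r0 : 0 < Num.sqrt (sqn c) by rewrite sqrtr_gt0.
have cE : c = Num.sqrt (sqn c) *: u by rewrite scalerA mulfV ?gt_eqF// scale1r.
have u1 : sqn u = 1.
  by rewrite sqnZ exprVn sqr_sqrtr ?mulVf ?gt_eqF// ltW.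
apply: le_trans (energy_deviation_unit u1).
rewrite (eq_bigl (fun a => n%:R * sigma2 / 2 < `|energy u a - n%:R * sigma2|))//.
move=> a; rewrite {2}cE energyZ sqr_sqrtr ?(ltW c0)// [X in X - _]mulrC -mulrBl.
by rewrite normrM (gtr0_norm c0) mulrAC ltr_pM2r.
Qed.

End bernoulli_matrix.

(** * Union bound over the grid *)

Section design_matrix.
Context {R : realType} {n p : nat}.
Variable q : R.
Hypothesis q_itv : 0 < q <= 2^-1.

Local Notation Omega := {ffun 'I_n -> {ffun 'I_p -> bool}}.

Definition mx_of_rows (a : Omega) : 'M[bool]_(n, p) := \matrix_(l, k) a l k.

Lemma sqn_mx_tilde (a : Omega) (v : 'cV[R]_p) :
  sqn (mx_tilde q (real_mx (mx_of_rows a)) *m v) =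
  (n%:R * (q * (1 - q)))^-1 * energy q v a.
Proof.
have /andP[q0 q2] := q_itv.
rewrite -scalemxAl sqnZ exprVn sqr_sqrtr -?mulrA; last first.
  by rewrite mulr_ge0// mulr_ge0//; lra.
congr (_ * _); apply: eq_bigr => l _; congr (_ ^+ 2).
rewrite mxE; apply: eq_bigr => k _; congr (_ * _).
by rewrite !mxE big_ord1 !mxE !mulr1.
Qed.

Definition deviates (v : 'cV[R]_p) (a : Omega) : bool :=
  n%:R * (q * (1 - q)) * sqn v / 2 <
  `|energy q v a - n%:R * (q * (1 - q)) * sqn v|.

Definition grid_bad (S : {set 'I_p}) (a : Omega) : bool :=
  [exists z : {ffun 'I_p -> 'I_((8 * #|S|).*2.+1)},
    (supp (gridv z : 'cV[R]_p) \subset S) && deviates (gridv z) a].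

Lemma riesz_of_not_bad (S : {set 'I_p}) a : (0 < n)%N -> (0 < #|S|)%N ->
  ~~ grid_bad S a -> forall v : 'cV[R]_p, supp v \subset S ->
  16^-1 * sqn v <= sqn (mx_tilde q (real_mx (mx_of_rows a)) *m v) <= 7 * sqn v.
Proof.
move=> n0 S0 good v vS; have /andP[q0 q2] := q_itv.
apply: (riesz_of_grid S0 erefl _ vS) => z zS.
move: good; rewrite negb_exists => /forallP/(_ z).
rewrite zS/= /deviates -leNgt ler_norml sqn_mx_tilde => /andP[h1 h2].
have s0 : 0 < n%:R * (q * (1 - q)).
  by rewrite mulr_gt0 ?ltr0n// mulr_gt0//; lra.
rewrite ler_pdivlMl// ler_pdivrMl//.
move: (n%:R * (q * (1 - q))) (sqn _) h1 h2 => r N h1 h2.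
by apply/andP; split; lra.
Qed.

(** With [X = n q^2 / (64 D)], the hypothesis reads [s ln p <= X / 7].  The
    grid has at most [(17 p)^s <= p^(6 s)] points, so the union bound gives
    [2 exp(6 s ln p - X) <= 2 exp(- s ln p) <= 2 / p]. *)
Lemma grid_bad_le (S : {set 'I_p}) : (2 <= p)%N -> (0 < #|S|)%N ->
  #|S|%:R <= (448 * bernstein_const)^-1 * (n%:R * q ^+ 2 / ln p%:R) ->
  \sum_(a | grid_bad S a) matw q a <= 2 / p%:R.
Proof.
move=> p2 S0 hS; set D : R := bernstein_const.
have [w0 _] := @is_dist_matw R n p q q_itv.
apply: (le_trans (sum_has_le _ _ w0)).
apply: (@le_trans _ _ (\sum_(z : {ffun 'I_p -> 'I_((8 * #|S|).*2.+1)} |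
    supp (gridv z : 'cV[R]_p) \subset S)
    2 * expR (- (n%:R * q ^+ 2 / (64 * D))))).
  by apply: ler_sum => z _; exact: energy_deviation.
rewrite sumr_const -[leLHS]mulr_natl.
set X := n%:R * q ^+ 2 / (64 * D).
have D0 : 0 < D by exact: bernstein_const_gt0.
have p0 : 0 < p%:R :> R by rewrite ltr0n (ltn_trans _ p2).
have lp : 0 < ln p%:R :> R by rewrite ln_gt0// ltr1n.
have sX : #|S|%:R * ln p%:R <= X / 7.
  rewrite -ler_pdivlMr// (le_trans hS)// le_eqVlt; apply/orP; left; apply/eqP.
  by rewrite /X -/D; field; rewrite !gt_eqF.
have lX : ln p%:R <= #|S|%:R * ln p%:R :> R by rewrite ler_peMl ?ler1n// ltW.
have card : (#|[pred z : {ffun 'I_p -> 'I_((8 * #|S|).*2.+1)} |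
    supp (gridv z : 'cV[R]_p) \subset S]|)%:R <= expR (6 * (#|S|%:R * ln p%:R)) :> R.
  apply: (@le_trans _ _ ((p ^ 6) ^ #|S|)%N%:R).
    rewrite ler_nat (leq_trans (card_gridv _ _))// leq_exp2r//.
    have Sp : (#|S| <= p)%N by rewrite -[leqRHS]card_ord max_card.
    have h : ((8 * #|S|).*2.+1 <= 2 ^ 5 * p)%N.
      rewrite -addnn -mulnDl (@leq_ltn_trans (16 * p))//.
        by rewrite leq_mul.
      by rewrite ltn_pmul2r// (ltn_trans _ p2).
    by rewrite (leq_trans h)// (expnSr p 5) leq_mul// leq_exp2r.
  rewrite -expnM natrX mulrA -natrM mulrC expRM_natr.
  by rewrite lnK ?posrE.
apply: (@le_trans _ _ (expR (6 * (#|S|%:R * ln p%:R)) * (2 * expR (- X)))).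
  by rewrite ler_wpM2r// mulr_ge0// expR_ge0.
rewrite mulrCA -expRD ler_wpM2l//.
by rewrite -[leRHS]lnK ?posrE ?invr_gt0// ler_expR lnV ?posrE//; lra.
Qed.

End design_matrix.

(** * From the random model to finite weights *)

Section transfer.
Context {R : realType} {d : measure_display} {T : measurableType d}.
Variable P : probability T R.

Lemma measurable_preimage_countable (K : countType) (f : T -> K) (B : set K) :
  (forall c, measurable (f @^-1` [set c])) -> measurable (f @^-1` B).
Proof.
move=> mf.
have -> : f @^-1` B = \bigcup_(i in [set i | exists2 c, B c & pickle c = i])
    (f @^-1` [set c | pickle c = i]).
  apply/seteqP; split => w /=; first by move=> Bw; exists (pickle (f w)) => //; exists (f w).
  move=> [_ [c Bc <-]]/= /(pcan_inj (@pickleK K)) fw.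
  by rewrite fw.
apply: bigcup_measurable => _ [c _ <-].
have -> : [set c' | pickle c' = pickle c] = [set c]; last exact: mf.
by apply/seteqP; split => c' /=; [exact: (pcan_inj (@pickleK K))|move=> ->].
Qed.

Context {n p : nat}.
Variables (A : 'I_n -> 'I_p -> {RV P >-> bool}) (Y : 'I_n -> {RV P >-> nat}).

Lemma measurable_random_mx (a : 'M[bool]_(n, p)) :
  measurable [set w | random_mx A w = a].
Proof.
have -> : [set w | random_mx A w = a] =
    \bigcap_(lk in [set: 'I_n * 'I_p]) (A lk.1 lk.2 @^-1` [set a lk.1 lk.2]).
  apply/seteqP; split => w /=; first by move=> <- lk _ /=; rewrite mxE.
  by move=> h; apply/matrixP => l k; rewrite mxE; exact: (h (l, k)).
by apply: fin_bigcap_measurable => // lk _; exact: measurable_funPTI.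
Qed.

Lemma measurable_random_cv (y : 'cV[nat]_n) :
  measurable [set w | random_cv Y w = y].
Proof.
have -> : [set w | random_cv Y w = y] =
    \bigcap_(l in [set: 'I_n]) (Y l @^-1` [set y l 0]).
  apply/seteqP; split => w /=; first by move=> <- l _ /=; rewrite mxE.
  by move=> h; apply/colP => l; rewrite mxE; exact: (h l).
by apply: fin_bigcap_measurable => // l _; exact: measurable_funPTI.
Qed.

(** [A] and [Y] take countably many values, so that every event that they
    determine is measurable, including those defined through the
    pseudo-inverse. *)
Lemma measurable_model_event (B : 'M[bool]_(n, p) -> 'cV[nat]_n -> Prop) :
  measurable [set w | B (random_mx A w) (random_cv Y w)].
Proof.
apply: (@measurable_preimage_countable _
  (fun w => (random_mx A w, random_cv Y w)) [set ay | B ay.1 ay.2]) => -[a y].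
have -> : (fun w => (random_mx A w, random_cv Y w)) @^-1` [set (a, y)] =
    [set w | random_mx A w = a] `&` [set w | random_cv Y w = y].
  by apply/seteqP; split => w /= => [[]|[-> ->]].
by apply: measurableI; [exact: measurable_random_mx|exact: measurable_random_cv].
Qed.

Variable q : R.
Hypothesis q_itv : 0 < q <= 2^-1.
Hypothesis A_indep : mutually_independent P
  (fun lk : 'I_n * 'I_p => A lk.1 lk.2 : T -> bool).
Hypothesis A_bern : forall l k (B : set bool),
  distribution P (A l k) B = bernoulli_prob q B.

Lemma random_mx_prob (a : {ffun 'I_n -> {ffun 'I_p -> bool}}) :
  P [set w | random_mx A w = mx_of_rows a] = (matw q a)%:E.
Proof.
have /andP[q0 q2] := q_itv.
have -> : [set w | random_mx A w = mx_of_rows a] =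
    \bigcap_(lk in [set` [set: 'I_n * 'I_p]%SET])
      (A lk.1 lk.2 @^-1` [set a lk.1 lk.2]).
  apply/seteqP; split => w /=.
    by move=> /matrixP wa lk _ /=; have := wa lk.1 lk.2; rewrite !mxE.
  move=> h; apply/matrixP => l k; rewrite !mxE; apply: (h (l, k)) => /=.
  by rewrite inE.
rewrite (A_indep [set: 'I_n * 'I_p]%SET (B := fun lk => [set a lk.1 lk.2]))//.
rewrite (eq_bigr (fun lk => (bernw q (a lk.1 lk.2))%:E)); last first.
  move=> lk _; have := A_bern lk.1 lk.2 [set a lk.1 lk.2].
  rewrite /distribution /pushforward => ->.
  rewrite bernoulli_probE; last by apply/andP; split; lra.
  rewrite !diracE; case: (a lk.1 lk.2).
    by rewrite mem_set// memNset// mule1 mule0 adde0.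
  by rewrite memNset// mem_set// mule1 mule0 add0e.
rewrite prodEFin; congr (_%:E); rewrite /matw /prodw pair_bigA/=.
by apply: eq_bigl => lk; rewrite inE.
Qed.

Lemma random_mx_event_le (b : pred {ffun 'I_n -> {ffun 'I_p -> bool}}) :
  (P [set w | exists2 a, b a & random_mx A w = mx_of_rows a] <=
   (\sum_(a | b a) matw q a)%:E)%E.
Proof.
have -> : [set w | exists2 a, b a & random_mx A w = mx_of_rows a] =
    \bigcup_(a in [set` b]) [set w | random_mx A w = mx_of_rows a].
  by apply/seteqP; split => w /= [a]; exists a.
apply: (@le_trans _ _ (\sum_(a \in [set` b])
    P [set w | random_mx A w = mx_of_rows a])%E).
  apply: content_sub_fsum => //.
    by move=> a _; exact: measurable_random_mx.
  by apply: fin_bigcup_measurable => // a _; exact: measurable_random_mx.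
rewrite -(@bigfs _ _ _ _ (index_enum _)) ?index_enum_uniq//; last first.
  by move=> a _; rewrite mem_index_enum.
by rewrite -sumEFin; under eq_bigr do rewrite random_mx_prob.
Qed.

End transfer.

(** * The oracle least squares error *)

Theorem proposition3 (R : realType) :
  exists c0 c1 c2 C : R, [/\ 0 < c0, 0 < c1, 0 < c2 & 0 < C] /\
  forall (n p : nat) (q : R) (x : 'cV[R]_p),
    (2 <= n)%N -> (2 <= p)%N -> 0 < q <= 2^-1 -> (forall k, 0 <= x k 0) ->
    (#|supp x|)%:R <= c0 * (n%:R * q ^+ 2 / ln p%:R) ->
  forall (d : measure_display) (T : measurableType d) (P : probability T R)
    (A : 'I_n -> 'I_p -> {RV P >-> bool}) (Y : 'I_n -> {RV P >-> nat}),
    bernoulli_poisson_model q x A Y ->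
    let At w : 'M[R]_(n, p) := mx_tilde q (real_mx (random_mx A w)) in
    let Yt w : 'cV[R]_n := cv_tilde q (real_cv (random_cv Y w)) in
    let Q w : R := \sum_(k in supp x)
      (((At w)^T *m (Yt w - At w *m x)) k 0) ^+ 2 in
    let err w : R := l2norm (ols (supp x) (At w) (Yt w) - x) ^+ 2 in
    ((1 - C / p%:R)%:E <
      P [set w | (c1 * Q w <= err w)%R /\ (err w <= c2 * Q w)%R])%E.
Proof.
exists (448 * bernstein_const)^-1, (7 ^- 2), (16^-1 ^- 2), 3; split.
  split; [|by rewrite invr_gt0 exprn_gt0|
    by rewrite invr_gt0 exprn_gt0 ?invr_gt0|by []].
  rewrite invr_gt0; apply: mulr_gt0; first by rewrite ltr0n.
  exact: bernstein_const_gt0.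
move=> n p q x n2 p2 q_itv _ hs d T P A Y [A_indep A_bern _]; cbv zeta.
set E := [set w | _].
(* Monotonicity of [P] holds between measurable sets only. *)
have mE : measurable E.
  pose Ma (a : 'M[bool]_(n, p)) : 'M[R]_(n, p) := mx_tilde q (real_mx a).
  pose Vy (y : 'cV[nat]_n) : 'cV[R]_n := cv_tilde q (real_cv y).
  pose Qf a y := \sum_(k in supp x) ((Ma a)^T *m (Vy y - Ma a *m x)) k 0 ^+ 2.
  pose ef a y := l2norm (ols (supp x) (Ma a) (Vy y) - x) ^+ 2.
  exact: (measurable_model_event A Y
    (fun a y => 7 ^- 2 * Qf a y <= ef a y /\ ef a y <= 16^-1 ^- 2 * Qf a y)).
have p0 : 0 < p%:R :> R by rewrite ltr0n (ltn_trans _ p2).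
(* If the support is empty, the grid is reduced to [0] and carries no
   information, but [0] is also the only vector supported there: the guard
   makes this case never bad. *)
pose bad (a : {ffun 'I_n -> {ffun 'I_p -> bool}}) :=
  (0 < #|supp x|)%N && grid_bad q (supp x) a.
pose F := [set w | exists2 a, bad a & random_mx A w = mx_of_rows a].
have mF : measurable F.
  exact: (measurable_model_event A Y
    (fun m _ => exists2 a, bad a & m = mx_of_rows a)).
have PF : (P F <= (2 / p%:R)%:E)%E.
  apply: (le_trans (random_mx_event_le q_itv A_indep A_bern bad)).
  rewrite lee_fin /bad; have [S0|S0] := posnP #|supp x|.
    by rewrite big_pred0 ?divr_ge0// => a; rewrite S0.
  exact: grid_bad_le.
have FE : ~` F `<=` E.
  move=> w nF; rewrite /E/= l2norm_sqr.
  apply: ols_error_bounds => // v vS.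
  pose a := [ffun l => [ffun k => A l k w]] : {ffun 'I_n -> {ffun 'I_p -> bool}}.
  have wa : random_mx A w = mx_of_rows a.
    by apply/matrixP => l k; rewrite !mxE !ffunE.
  have [S0|S0] := posnP #|supp x|.
    have -> : v = 0.
      apply/colP => k; rewrite mxE; apply: (supp_notin vS).
      by move/eqP: S0; rewrite cards_eq0 => /eqP ->; rewrite inE.
    by rewrite mulmx0 /sqn !big1 ?mulr0 ?lexx// => i _; rewrite mxE expr0n.
  rewrite wa; apply: (riesz_of_not_bad q_itv _ S0 _ vS).
    exact: ltn_trans n2.
  by apply/negP => ba; apply: nF; exists a => //; rewrite /bad S0.
apply: (@lt_le_trans _ _ (P (~` F))); last first.
  by apply: le_measure => //; rewrite inE//; exact: measurableC.
rewrite probability_setC// (@lt_le_trans _ _ (1 - (2 / p%:R)%:E)%E)//.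
  by rewrite -EFinB lte_fin ltrD2l ltrN2 ltr_pM2r ?invr_gt0// ltr_nat.
exact: leeB.
Qed.
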